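(* Let $\omega_m$ be the aggregated ranking maintained by the LR-Aggregation algorithm for the list $\Pi_m=[\pi_1,\dots,\pi_m]$ of rankings of an $n$-element set $U$. After receiving a new ranking $\pi_{m+1}$, the LR-Aggregation algorithm computes the aggregated ranking $\omega_{m+1}$ of $\Pi_{m+1}=[\pi_1,\dots,\pi_{m+1}]$ in $O(n\log n)$ time.
   Context: A ranking of $U$, $|U|=n$, is a bijection $\pi:U\to\{1,\dots,n\}$; assume $n=2^k$. LR-trees: for each $e\in U$, $T(e)$ is a complete binary tree whose root corresponds to the interval $[1:n]$, each node with interval $[a:b]$, $a<b$, has left child with interval $[a:(a+b-1)/2]$ and right child with interval $[(a+b+1)/2:b]$, leaves are $[i:i]$; each node $u$ stores $p(u)=\#\{\pi\in\Pi:\pi(e)\in I(u)\}$ for the current list $\Pi$, and for non-leaf $u$, $\mathrm{score}(u)=\#\{\pi\in\Pi:\ \pi(e)\le b'\}$ where $b'$ is the right endpoint of the interval of the left child of $u$ (so $\mathrm{score}(\text{root})=p(lc(\text{root}))$, $\mathrm{score}(u)=\mathrm{score}(par(u))-p(rc(u))$ if $u$ is a left child, $\mathrm{score}(u)=\mathrm{score}(par(u))+p(lc(u))$ if $u$ is a right child). LR-Aggregation algorithm: an array $\mathbf{A}$ holds the elements in the order of $\omega_m$. On receiving $\pi_{m+1}$: (1) for each $e$, increment $p$ of every node of $T(e)$ whose interval contains $\pi_{m+1}(e)$; (2) attach to each entry of $\mathbf{A}$ a current node, initially the root of that element's LR-tree, and the score of that node; (3) run the recursive procedure on $\mathbf{A}[1..n]$: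 for a subarray $\mathbf{A}[s..t]$, let $mid=\lfloor (s+t)/2\rfloor$; partition the subarray around the median score so that the elements with the highest scores occupy $\mathbf{A}[s..mid]$ (ties broken by keeping the order of the previous aggregated ranking); if $s+1<t$, move the current node of each element in $\mathbf{A}[s..mid]$ to its left child and of each element in $\mathbf{A}[mid+1..t]$ to its right child, update their scores, and recurse on $\mathbf{A}[s..mid]$ and $\mathbf{A}[mid+1..t]$. The final order in $\mathbf{A}$ is $\omega_{m+1}$. Model of computation: counters take $O(1)$ space and arithmetic on them takes $O(1)$ time (real RAM). *)

(* Defs.v *)
From mathcomp Require Import all_boot.
Set Implicit Arguments.
Unset Strict Implicit.
Unset Printing Implicit Defensive.

(** * Timed computations

    [(x, c) : timed X] is a computation with result [x] and running time [c] in
    the unit-cost RAM. [op x] is one constant-time step producing [x]: a bounded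
    number of comparisons, counter operations, array reads or writes,
    allocations of a list cell or tree node. Every step of the programs below
    goes through [op], and time is accumulated only by [bind]. *)

Definition timed (X : Type) : Type := (X * nat)%type.
Definition result (X : Type) (m : timed X) : X := m.1.
Definition time (X : Type) (m : timed X) : nat := m.2.
Definition op (X : Type) (x : X) : timed X := (x, 1).
Definition bind (X Y : Type) (m : timed X) (f : X -> timed Y) : timed Y :=
  let m' := f (result m) in (result m', time m + time m').

Notation "'let!' x := m 'in' f" := (bind m (fun x => f))
  (at level 200, x name, m at level 100, f at level 200).

Fixpoint tmap (X Y : Type) (f : X -> timed Y) (s : seq X) : timed (seq Y) :=
  match s with
  | [::] => op [::]
  | x :: s' => let! y := f x in let! ys := tmap f s' in op (y :: ys)
  end.

Fixpoint tcat (X : Type) (s1 s2 : seq X) : timed (seq X) :=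
  match s1 with
  | [::] => op s2
  | x :: s1' => let! s := tcat s1' s2 in op (x :: s)
  end.

Fixpoint tsize (X : Type) (s : seq X) : timed nat :=
  match s with
  | [::] => op 0
  | _ :: s' => let! n := tsize s' in op n.+1
  end.

Fixpoint tnth_seq (s : seq nat) (j : nat) : timed nat :=
  match s, j with
  | [::], _ => op 0
  | x :: _, 0 => op x
  | _ :: s', j'.+1 => let! _ := op tt in tnth_seq s' j'
  end.

(** * Worst-case linear-time selection (median of medians, groups of five) *)

Fixpoint tinsert (x : nat) (s : seq nat) : timed (seq nat) :=
  match s with
  | [::] => op [:: x]
  | y :: s' =>
      let! le_yx := op (y <= x) in
      if le_yx then op (x :: s) else let! r := tinsert x s' in op (y :: r)
  end.

(* Insertion sort, in decreasing order. *)
Fixpoint tsort (s : seq nat) : timed (seq nat) :=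
  match s with
  | [::] => op [::]
  | x :: s' => let! r := tsort s' in tinsert x r
  end.

Fixpoint tgroups5 (s : seq nat) : timed (seq (seq nat)) :=
  match s with
  | [::] => op [::]
  | a :: b :: c :: d :: e :: s' =>
      let! r := tgroups5 s' in op ([:: a; b; c; d; e] :: r)
  | _ => op [:: s]
  end.

Definition tgroup_median (g : seq nat) : timed nat :=
  let! r := tsort g in
  let! n := tsize r in
  let! j := op n./2 in
  tnth_seq r j.

(* The elements larger than [v], those equal to [v], those smaller than [v]. *)
Fixpoint tpartition3 (v : nat) (s : seq nat)
  : timed (seq nat * seq nat * seq nat) :=
  match s with
  | [::] => op ([::], [::], [::])
  | x :: s' =>
      let! r := tpartition3 v s' in
      let: (gt, eq, lt) := r in
      let! gt_xv := op (v < x) in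
      if gt_xv then op (x :: gt, eq, lt) else
      let! eq_xv := op (x == v) in
      if eq_xv then op (gt, x :: eq, lt) else op (gt, eq, x :: lt)
  end.

Definition select_cutoff : nat := 100.

(* The entry of index [j] (from 0) of [s] in decreasing order, for
   [j < size s]. Recursive calls are on strictly shorter lists, so any
   [fuel >= size s] is enough. *)
Fixpoint tselect (fuel : nat) (s : seq nat) (j : nat) : timed nat :=
  match fuel with
  | 0 => op 0
  | fuel'.+1 =>
      let! n := tsize s in
      let! small := op (n <= select_cutoff) in
      if small then let! r := tsort s in tnth_seq r j else
      let! groups := tgroups5 s in
      let! meds := tmap tgroup_median groups in
      let! q := tsize meds in
      let! h := op q./2 in
      let! v := tselect fuel' meds h in
      let! parts := tpartition3 v s in
      let: (gt, eq, lt) := parts in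
      let! ngt := tsize gt in
      let! in_gt := op (j < ngt) in
      if in_gt then tselect fuel' gt j else
      let! neq := tsize eq in
      let! in_eq := op (j < ngt + neq) in
      if in_eq then op v else
      let! j' := op (j - (ngt + neq)) in
      tselect fuel' lt j'
  end.

(** * LR-trees *)

(* [LRnode a b p l r] has interval [a:b] and counter [p]; [LRleaf i p] has
   interval [i:i] and counter [p]. *)
Inductive lrtree : Type :=
| LRleaf (i p : nat)
| LRnode (a b p : nat) (l r : lrtree).

Definition node_p (u : lrtree) : nat :=
  match u with LRleaf _ p => p | LRnode _ _ p _ _ => p end.

(* [p(lc(u))] and [p(rc(u))]; the value 0 on leaves is only read when the whole
   tree is a single leaf, i.e. when there is a single element. *)
Definition p_lc (u : lrtree) : nat :=
  match u with LRleaf _ _ => 0 | LRnode _ _ _ l _ => node_p l end.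
Definition p_rc (u : lrtree) : nat :=
  match u with LRleaf _ _ => 0 | LRnode _ _ _ _ r => node_p r end.

Definition lc (u : lrtree) : lrtree :=
  match u with LRleaf _ _ => u | LRnode _ _ _ l _ => l end.
Definition rc (u : lrtree) : lrtree :=
  match u with LRleaf _ _ => u | LRnode _ _ _ _ r => r end.

Fixpoint lr_subtree (U : finType) (Pi : seq {ffun U -> nat}) (e : U)
    (k a b : nat) : lrtree :=
  let p := count (fun pi : {ffun U -> nat} => a <= pi e <= b) Pi in
  match k with
  | 0 => LRleaf a p
  | k'.+1 =>
      LRnode a b p
        (lr_subtree Pi e k' a ((a + b - 1) %/ 2))
        (lr_subtree Pi e k' ((a + b + 1) %/ 2) b)
  end.

(* The LR-tree [T(e)] for the list [Pi], when [#|U| = 2 ^ k]. *)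
Definition lr_tree (U : finType) (k : nat) (Pi : seq {ffun U -> nat}) (e : U)
  : lrtree := lr_subtree Pi e k 1 #|U|.

Fixpoint tincr (x : nat) (u : lrtree) : timed lrtree :=
  match u with
  | LRleaf i p =>
      let! hit := op (i == x) in
      if hit then op (LRleaf i p.+1) else op u
  | LRnode a b p l r =>
      let! hit := op (a <= x <= b) in
      if hit then
        let! l' := tincr x l in
        let! r' := tincr x r in
        op (LRnode a b p.+1 l' r')
      else op u
  end.

(** * The LR-Aggregation algorithm *)

Record entry (X : Type) : Type :=
  Entry { elt : X; cur : lrtree; score : nat }.

Definition move_left (X : Type) (x : entry X) : timed (entry X) :=
  let! u := op (lc (cur x)) in
  let! sc := op (score x - p_rc u) in
  op (Entry (elt x) u sc).

Definition move_right (X : Type) (x : entry X) : timed (entry X) :=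
  let! u := op (rc (cur x)) in
  let! sc := op (score x + p_lc u) in
  op (Entry (elt x) u sc).

Fixpoint tcount_above (X : Type) (v : nat) (B : seq (entry X)) : timed nat :=
  match B with
  | [::] => op 0
  | x :: B' =>
      let! n := tcount_above v B' in
      let! above := op (v < score x) in
      if above then op n.+1 else op n
  end.

(* Left: the entries with score above [v] and the first [r] ones with score
   exactly [v]. Both sides keep the order of [B]. *)
Fixpoint tsplit (X : Type) (v r : nat) (B : seq (entry X))
  : timed (seq (entry X) * seq (entry X)) :=
  match B with
  | [::] => op ([::], [::])
  | x :: B' =>
      let! above := op (v < score x) in
      if above then
        let! LR := tsplit v r B' in op (x :: LR.1, LR.2)
      else
        let! tie := op ((score x == v) && (0 < r)) in
        if tie then
          let! LR := tsplit v r.-1 B' in op (x :: LR.1, LR.2)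
        else
          let! LR := tsplit v r B' in op (LR.1, x :: LR.2)
  end.

(* Partition of [B = A[s..t]] around the median score into [A[s..mid]] and
   [A[mid+1..t]]. As [A] starts in the order of the previous aggregated ranking
   and the partition is stable, the order of [B] is the order of the previous
   aggregated ranking, which is the one used to break ties. *)
Definition tpartition_median (X : Type) (s mid t : nat) (B : seq (entry X))
  : timed (seq (entry X) * seq (entry X)) :=
  let! scores := tmap (fun x => op (score x)) B in
  let! v := tselect (t - s).+1 scores (mid - s) in
  let! g := tcount_above v B in
  let! r := op ((mid - s).+1 - g) in
  tsplit v r B.

(* The recursive procedure on [A[s..t]], given as the list [B] of its entries.
   [fuel] bounds the depth of the recursion; [fuel >= t - s + 1] is enough. *)
Fixpoint lr_rec (X : Type) (fuel s t : nat) (B : seq (entry X))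
  : timed (seq (entry X)) :=
  match fuel with
  | 0 => op B
  | fuel'.+1 =>
      let! mid := op ((s + t) %/ 2) in
      let! LR := tpartition_median s mid t B in
      let! deeper := op (s + 1 < t) in
      if deeper then
        let! L := tmap (@move_left X) LR.1 in
        let! R := tmap (@move_right X) LR.2 in
        let! L' := lr_rec fuel' s mid L in
        let! R' := lr_rec fuel' mid.+1 t R in
        tcat L' R'
      else tcat LR.1 LR.2
  end.

(* The data kept between two rankings: the array [A] and the LR-trees, the
   latter as an array indexed by the elements. *)
Record lr_state (U : finType) : Type :=
  LRState { st_A : seq U; st_T : {ffun U -> lrtree} }.

Definition set_tree (U : finType) (T : {ffun U -> lrtree}) (e : U) (u : lrtree)
  : {ffun U -> lrtree} := [ffun x => if x == e then u else T x].

Fixpoint tupdate_trees (U : finType) (pi : {ffun U -> nat}) (A : seq U)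
    (T : {ffun U -> lrtree}) : timed {ffun U -> lrtree} :=
  match A with
  | [::] => op T
  | e :: A' =>
      let! x := op (pi e) in
      let! u := op (T e) in
      let! u' := tincr x u in
      let! T' := op (set_tree T e u') in
      tupdate_trees pi A' T'
  end.

Definition tattach (U : finType) (T : {ffun U -> lrtree}) (e : U)
  : timed (entry U) :=
  let! u := op (T e) in
  let! sc := op (p_lc u) in
  op (Entry e u sc).

Definition lr_step (U : finType) (st : lr_state U) (pi : {ffun U -> nat})
  : timed (lr_state U) :=
  let! T := tupdate_trees pi (st_A st) (st_T st) in
  let! B := tmap (tattach T) (st_A st) in
  let! B' := lr_rec #|U| 1 #|U| B in
  let! A := tmap (fun x => op (elt x)) B' in
  op (LRState A T).

(* The state before any ranking is received; [A0] is an arbitrary order. *)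
Definition lr_init (U : finType) (k : nat) (A0 : seq U) : lr_state U :=
  LRState A0 [ffun e => lr_tree k [::] e].

Definition lr_run (U : finType) (k : nat) (A0 : seq U)
    (Pi : seq {ffun U -> nat}) : lr_state U :=
  foldl (fun st pi => result (lr_step st pi)) (lr_init k A0) Pi.

(** * Rankings and the aggregated ranking *)

Definition is_ranking (U : finType) (pi : {ffun U -> nat}) : Prop :=
  injective pi /\ forall i : nat, 1 <= i <= #|U| <-> exists e : U, pi e = i.

Definition ranking_of (U : finType) (A : seq U) : {ffun U -> nat} :=
  [ffun e => (index e A).+1].

(* [lr_interval n a b]: [a:b] is the interval of a node of the LR-trees. *)
Inductive lr_interval (n : nat) : nat -> nat -> Prop :=
| lr_interval_root : lr_interval n 1 n
| lr_interval_left a b :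
    lr_interval n a b -> a < b -> lr_interval n a ((a + b - 1) %/ 2)
| lr_interval_right a b :
    lr_interval n a b -> a < b -> lr_interval n ((a + b + 1) %/ 2) b.

(* The score of the node of [T(e)] whose left child has right endpoint [b]. *)
Definition lr_score (U : finType) (Pi : seq {ffun U -> nat}) (b : nat) (e : U)
  : nat := count (fun pi : {ffun U -> nat} => pi e <= b) Pi.

(* [w'] is the aggregated ranking of [Pi], with ties broken by the previous
   aggregated ranking [w]: for every non-leaf node [a:b], among the elements
   placed in [a:b], those in the left half precede those in the right half for
   decreasing score, then for increasing [w]. This determines [w']. *)
Definition is_aggregated_ranking (U : finType) (Pi : seq {ffun U -> nat})
    (w w' : {ffun U -> nat}) : Prop :=
  is_ranking w' /\
  forall (a b : nat) (e f : U), lr_interval #|U| a b -> a < b ->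
    let b' := (a + b - 1) %/ 2 in
    a <= w' e <= b' -> b' < w' f <= b ->
    lr_score Pi b' f < lr_score Pi b' e \/
    lr_score Pi b' e = lr_score Pi b' f /\ w e < w f.

(* Main.v *)
(** The partition around the median costs linear time because selection does:
    the median of medians [v] of [s] has at least about [3/10] of [s] on each
    side, so the two recursive calls have total size at most about [9/10] of
    [size s], and any large slope, here [300], absorbs the linear overhead. The
    recursive procedure then has [log n] levels of total cost [O(n)], and
    updating the LR-tree of one element only follows a root-to-leaf path.

    Correctness rests on one invariant of the recursion: on the block [A[s..t]]
    the current node of every element has interval [s:t], its score counts the
    rankings placing the element in the left half or before it, and the block
    is listed in the order of the previous aggregated ranking. *)

Require Import Defs.
From mathcomp Require Import all_boot zify.
Set Implicit Arguments.
Unset Strict Implicit.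
Unset Printing Implicit Defensive.

(** * Results and running times of timed programs *)

Arguments result : simpl never.
Arguments time : simpl never.
Arguments op : simpl never.
Arguments bind : simpl never.

Lemma result_bind X Y (m : timed X) (f : X -> timed Y) :
  result (bind m f) = result (f (result m)).
Proof. by []. Qed.

Lemma time_bind X Y (m : timed X) (f : X -> timed Y) :
  time (bind m f) = time m + time (f (result m)).
Proof. by []. Qed.

Lemma result_op X (x : X) : result (op x) = x. Proof. by []. Qed.
Lemma time_op X (x : X) : time (op x) = 1. Proof. by []. Qed.

Definition timedE :=
  (result_bind, time_bind, result_op, time_op).

Lemma result_tmap X Y (f : X -> timed Y) s :
  result (tmap f s) = map (fun x => result (f x)) s.
Proof. by elim: s => //= x s IH; rewrite !timedE IH. Qed.

Lemma time_tmap X Y (f : X -> timed Y) c s :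
  (forall x, time (f x) <= c) -> time (tmap f s) <= c.+1 * size s + 1.
Proof.
move=> fc; elim: s => [|x s IH] /=; rewrite !timedE ?muln0 //.
by have := fc x; rewrite mulnS; lia.
Qed.

Lemma result_tcat X (s1 s2 : seq X) : result (tcat s1 s2) = s1 ++ s2.
Proof. by elim: s1 => //= x s1 IH; rewrite !timedE IH. Qed.

Lemma time_tcat X (s1 s2 : seq X) : time (tcat s1 s2) = (size s1).+1.
Proof. by elim: s1 => //= x s1 IH; rewrite !timedE IH; lia. Qed.

Lemma result_tsize X (s : seq X) : result (Defs.tsize s) = size s.
Proof. by elim: s => //= x s IH; rewrite !timedE IH. Qed.

Lemma time_tsize X (s : seq X) : time (Defs.tsize s) = (size s).+1.
Proof. by elim: s => //= x s IH; rewrite !timedE IH; lia. Qed.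

Lemma result_tnth_seq s j : result (tnth_seq s j) = nth 0 s j.
Proof. by elim: s j => [|x s IH] [|j] //=; rewrite !timedE IH. Qed.

Lemma time_tnth_seq s j : time (tnth_seq s j) <= (size s).+1.
Proof. by elim: s j => [|x s IH] [|j] //=; rewrite !timedE; have := IH j; lia. Qed.

(** * Selection *)

Lemma perm_tinsert x s : perm_eq (result (tinsert x s)) (x :: s).
Proof.
elim: s => //= y s IH; rewrite !timedE; case: (y <= x) => //; rewrite !timedE.
rewrite -(perm_cons y) in IH; apply: (perm_trans IH).
by rewrite (perm_catCA [:: y] [:: x] s).
Qed.

Lemma sorted_tinsert x s : sorted geq s -> sorted geq (result (tinsert x s)).
Proof.
have tr : transitive geq by move=> a b c /=; lia.
elim: s => //= y s IH ys; rewrite !timedE.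
case: (leqP y x) => yx; rewrite !timedE /=; first by rewrite /geq yx ys.
rewrite path_sortedE // (IH (path_sorted ys)) andbT.
rewrite (perm_all _ (perm_tinsert x s)) /= (ltnW yx) /=.
by move: ys; rewrite path_sortedE // => /andP[].
Qed.

Lemma time_tinsert x s : time (tinsert x s) <= (size s).*2.+1.
Proof. by elim: s => //= y s IH; rewrite !timedE; case: ifP; rewrite ?timedE; lia. Qed.

Lemma perm_tsort s : perm_eq (result (tsort s)) s.
Proof.
elim: s => //= x s IH; rewrite !timedE.
by apply: (perm_trans (perm_tinsert _ _)); rewrite perm_cons.
Qed.

Lemma sorted_tsort s : sorted geq (result (tsort s)).
Proof. by elim: s => //= x s IH; rewrite !timedE sorted_tinsert. Qed.

Lemma size_tsort s : size (result (tsort s)) = size s.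
Proof. exact: perm_size (perm_tsort s). Qed.

(** A quadratic bound is enough: the sort runs only on groups of at most five entries and on lists
    within the cutoff. *)
Lemma time_tsort s : time (tsort s) <= size s * size s + 1.
Proof.
elim: s => //= x s IH; rewrite !timedE.
by have := time_tinsert x (result (tsort s)); rewrite size_tsort; nia.
Qed.

(* [v] has rank [j] (from 0) in the decreasing order of [s]. *)
Definition is_rank (s : seq nat) (j v : nat) : bool :=
  count (fun x => v < x) s <= j < count (fun x => v <= x) s.

Lemma is_rank_perm s s' j v : perm_eq s s' -> is_rank s j v = is_rank s' j v.
Proof. by move=> ss'; rewrite /is_rank !(permP ss'). Qed.

Lemma count_le_split v s :
  count (fun x => v <= x) s = count (fun x => v < x) s + count (fun x => x == v) s.
Proof. by elim: s => //= x s ->; lia. Qed.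

Lemma count_ge_split v s :
  count (fun x => x <= v) s + count (fun x => v < x) s = size s.
Proof. by elim: s => //= x s <-; lia. Qed.

Lemma count_lt_split v s :
  count (fun x => x < v) s + count (fun x => v <= x) s = size s.
Proof. by elim: s => //= x s <-; lia. Qed.

Lemma is_rank_mem s j v : is_rank s j v -> v \in s.
Proof.
rewrite /is_rank (count_le_split v) => r.
have : 0 < count (fun x => x == v) s by lia.
by rewrite -has_count => /hasP[x xs /eqP <-].
Qed.

Lemma is_rank_nth s j : sorted geq s -> j < size s -> is_rank s j (nth 0 s j).
Proof.
have tr : transitive geq by move=> a b c /=; lia.
elim: s j => //= x s IH j; rewrite path_sortedE // => /andP[/allP xs ss] js.
rewrite /is_rank /=.
case: j js => [|j] /= js.
  suff -> : count (fun y => x < y) s = 0 by rewrite ltnn leqnn.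
  by apply/eqP; rewrite -leqn0 leqNgt -has_count; apply/hasPn => y /xs /=; lia.
have := IH _ ss js; have /= := xs _ (mem_nth 0 js); rewrite /is_rank.
by move: (nth 0 s j) => v; lia.
Qed.

Lemma result_tpartition3 v s :
  result (tpartition3 v s) =
  (filter (fun x => v < x) s, filter (fun x => x == v) s, filter (fun x => x < v) s).
Proof.
elim: s => //= x s IH; rewrite result_bind IH !timedE.
by case: (ltngtP v x) => vx; rewrite !timedE //=; case: eqP => ?; rewrite ?timedE //; lia.
Qed.

Lemma time_tpartition3 v s : time (tpartition3 v s) <= 3 * size s + 1.
Proof.
elim: s => //= x s IH; rewrite time_bind result_tpartition3 !timedE.
by case: ifP; rewrite ?timedE; [lia | case: ifP; rewrite !timedE; lia].
Qed.

(** The entries of [s] that are [>= x] all exceed [v], as [x] itself does, so filtering changes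
    neither of the two counts. *)
Lemma is_rank_above v s j x :
  is_rank (filter (fun y => v < y) s) j x -> is_rank s j x.
Proof.
move=> rx; have := is_rank_mem rx; rewrite mem_filter => /andP[vx _].
move: rx; rewrite /is_rank !count_filter.
have -> : count (predI (fun y => x < y) (fun y => v < y)) s = count (fun y => x < y) s.
  by apply: eq_count => y /=; lia.
by have -> : count (predI (fun y => x <= y) (fun y => v < y)) s = count (fun y => x <= y) s;
  first by apply: eq_count => y /=; lia.
Qed.

(** Every entry [>= v] exceeds [x], so putting these entries back raises both counts by the same
    amount, which is the shift applied to [j]. *)
Lemma is_rank_below v s j x :
  count (fun y => v <= y) s <= j ->
  is_rank (filter (fun y => y < v) s) (j - count (fun y => v <= y) s) x ->
  is_rank s j x.
Proof.
move=> sj rx; have := is_rank_mem rx; rewrite mem_filter => /andP[xv _].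
have E (P : pred nat) : (forall y, v <= y -> P y) ->
    count P s = count P (filter (fun y => y < v) s) + count (fun y => v <= y) s.
  by move=> vP; rewrite count_filter; elim: (s) => //= y s' ->; have := vP y; lia.
move: rx; rewrite /is_rank (E (fun y => x < y)) ?(E (fun y => x <= y)); lia.
Qed.

(** * Median of medians *)

(** Induction along the recursion of [tgroups5], with an incomplete group as base case. *)
Lemma seq5_ind (P : seq nat -> Prop) :
  (forall s, size s < 5 -> P s) ->
  (forall a b c d e s, P s -> P [:: a, b, c, d, e & s]) ->
  forall s, P s.
Proof.
move=> P4 P5 s; have [n] := ubnP (size s); elim: n s => // n IH.
move=> [|a [|b [|c [|d [|e s]]]]] sn; try exact: P4.
by apply/P5/IH; move: sn => /=; lia.
Qed.

Lemma tgroups5_small s :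
  size s < 5 -> tgroups5 s = op (if s is [::] then [::] else [:: s]).
Proof. by move: s => [|a [|b [|c [|d [|e s]]]]]. Qed.

Lemma tgroups5_big a b c d e s :
  tgroups5 [:: a, b, c, d, e & s] =
  let! r := tgroups5 s in op ([:: a; b; c; d; e] :: r).
Proof. by []. Qed.

Lemma size_tgroups5 s :
  size s <= 5 * size (result (tgroups5 s)) <= size s + 4.
Proof.
elim/seq5_ind: s => [s s5|a b c d e s IH].
  by rewrite tgroups5_small // timedE; case: s s5 => //= x s; lia.
by rewrite tgroups5_big !timedE /=; lia.
Qed.

Lemma time_tgroups5 s : time (tgroups5 s) <= size s + 1.
Proof.
elim/seq5_ind: s => [s s5|a b c d e s IH]; first by rewrite tgroups5_small // timedE; lia.
by rewrite tgroups5_big !timedE /=; lia.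
Qed.

Lemma groups5_size_le s : all (fun g => size g <= 5) (result (tgroups5 s)).
Proof.
elim/seq5_ind: s => [s s5|a b c d e s IH].
  by rewrite tgroups5_small // timedE; case: s s5 => //= x s; lia.
by rewrite tgroups5_big !timedE /=.
Qed.

Lemma result_tgroup_median g :
  result (tgroup_median g) = nth 0 (result (tsort g)) (size g)./2.
Proof. by rewrite /tgroup_median !timedE result_tnth_seq result_tsize size_tsort. Qed.

Lemma time_tgroup_median g : size g <= 5 -> time (tgroup_median g) <= 39.
Proof.
move=> g5; rewrite /tgroup_median !timedE time_tsize.
have := time_tnth_seq (result (tsort g)) (result (Defs.tsize (result (tsort g))))./2.
have := time_tsort g; have := leq_mul g5 g5; rewrite size_tsort; lia.
Qed.

Lemma time_tmap_tgroup_median gs :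
  all (fun g => size g <= 5) gs -> time (tmap tgroup_median gs) <= 40 * size gs + 1.
Proof.
elim: gs => //= g gs IH /andP[g5 /IH].
rewrite time_bind (time_bind (tmap _ _)) time_op.
by have := time_tgroup_median g5; lia.
Qed.

Definition medians s :=
  map (fun g => result (tgroup_median g)) (result (tgroups5 s)).

(** Upward-closed or downward-closed predicates: one counting argument then serves both sides of the
    pivot, with [v <= x] and with [x <= v]. *)
Definition halfline (P : pred nat) :=
  (forall x y, x <= y -> P x -> P y) \/ (forall x y, x <= y -> P y -> P x).

(** In a sorted group of five, closure carries [P] from the median to the two entries on one side of
    it, hence three. Any other group is credited only with its median. *)
Lemma count_group_median P g : halfline P -> 0 < size g ->
  P (result (tgroup_median g)) -> (if size g == 5 then 3 else 1) <= count P g.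
Proof.
move=> mP g0; rewrite result_tgroup_median -(permP (perm_tsort g)).
have := sorted_tsort g; rewrite -!(size_tsort g) in g0 *.
move: (result _) g0 => r g0 rs Pm; case: eqP => r5; last first.
  by rewrite -has_count; apply/hasP; exists (nth 0 r (size r)./2) => //;
    apply: mem_nth; rewrite -divn2 ltn_Pdiv.
move: r r5 {g0} rs Pm => [|a [|b [|c [|d [|e [|]]]]]] //= _ /and5P[ba cb dc ed _] Pc.
by case: mP => mP; [have Pb := mP _ _ cb Pc; have Pa := mP _ _ ba Pb
                  | have Pd := mP _ _ dc Pc; have Pe := mP _ _ ed Pd]; lia.
Qed.

(** Each full group with a median in [P] pays 3 entries. Only the last group may be short, and it
    pays at least 1 instead of 3, whence the 2. *)
Lemma count_medians P s : halfline P -> 3 * count P (medians s) <= count P s + 2.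
Proof.
move=> mP; rewrite /medians; elim/seq5_ind: s => [s s5|a b c d e s IH].
  rewrite tgroups5_small // timedE; case: s s5 => // x s s5.
  rewrite [map _ _]/= [count P [:: _]]/= addn0.
  have := @count_group_median P (x :: s) mP isT.
  case: (P (result _)) => /=; last by rewrite muln0.
  by move=> /(_ isT); case: ifP; lia.
rewrite tgroups5_big !timedE [map _ _]/=.
have := @count_group_median P [:: a; b; c; d; e] mP isT.
rewrite -[[:: a, b, c, d, e & s]]/([:: a; b; c; d; e] ++ s) count_cat.
set g := [:: a; b; c; d; e]; rewrite -[count P (_ :: map _ _)]/(P _ + count P _).
move: (P (result (tgroup_median g))) (count P g) => [] n; last by move=> _ /=; lia.
by move=> /(_ isT) /=; lia.
Qed.

Lemma size_medians s : size s <= 5 * size (medians s) <= size s + 4.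
Proof. by rewrite size_map size_tgroups5. Qed.

(** At least half of the medians are [>= v] and at least half are [<= v]. By [count_medians] each of
    these conditions holds on [3/10] of [s] up to 2 entries, and the strict opposite sides are the
    complements. The 20 is ten times that 2. *)
Lemma median_of_medians v s : is_rank (medians s) (size (medians s))./2 v ->
  10 * count (fun x => v < x) s <= 7 * size s + 20 /\
  10 * count (fun x => x < v) s <= 7 * size s + 20.
Proof.
move=> /andP[gt ge].
have up : halfline (fun x => v <= x) by left => x y; lia.
have dn : halfline (fun x => x <= v) by right => x y; lia.
have := count_medians s up; have := count_medians s dn.
have := count_ge_split v s; have := count_lt_split v s.
have := count_ge_split v (medians s); have := size_medians s.
lia.
Qed.

(** Correctness and cost are proved together, since the cost bound needs the pivot to be a true
    median of the medians. The 4 is the cost on the empty list; above the cutoff, [size s > 100]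
    absorbs the additive terms. *)
Lemma tselectP fuel s j : size s <= fuel -> 0 < fuel ->
  (j < size s -> is_rank s j (result (tselect fuel s j))) /\
  time (tselect fuel s j) <= 300 * size s + 4.
Proof.
elim: fuel s j => // fuel IH s j sf _ /=.
rewrite !timedE result_tsize time_tsize /select_cutoff.
case: (leqP (size s) 100) => s100; rewrite !timedE.
  rewrite result_tnth_seq; split => [js|].
    rewrite -(is_rank_perm _ _ (perm_tsort s)).
    by apply: is_rank_nth; rewrite ?size_tsort ?sorted_tsort.
  have := time_tsort s; have := time_tnth_seq (result (tsort s)) j.
  (* Within the cutoff, the quadratic sort has slope at most 100. *)
  have : size s * size s <= 100 * size s by rewrite leq_mul2r s100 orbT.
  rewrite size_tsort; lia.
rewrite result_tmap -/(medians s) !result_tsize !time_tsize.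
have ms := size_medians s.
have tg := time_tgroups5 s; have := time_tmap_tgroup_median (groups5_size_le s).
rewrite -[size (result (tgroups5 s))](size_map (fun g => result (tgroup_median g))).
rewrite -/(medians s) => tm.
have [||] := IH (medians s) (size (medians s))./2; [lia|lia|].
move: (tselect _ _ _) => tv /(_ ltac:(lia)) rv tvt.
have [gtv ltv] := median_of_medians rv.
have tp := time_tpartition3 (result tv) s.
rewrite result_tpartition3 !timedE !result_tsize !time_tsize !size_filter.
move: (result tv) rv gtv ltv tp => v rv gtv ltv tp.
have cs := count_le_split v s; have cl := count_lt_split v s.
case: (ltnP j (count (fun x => v < x) s)) => jg; rewrite ?timedE.
  have [||] := IH (filter (fun x => v < x) s) j; rewrite ?size_filter; [lia|lia|].
  move=> R T; split; last by lia.
  by move=> _; apply: is_rank_above (R jg).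
rewrite result_tsize time_tsize !size_filter.
case: (ltnP j (count (fun x => v < x) s + count (fun x => x == v) s)) => je; rewrite ?timedE.
  split; first by rewrite /is_rank jg cs je.
  by move: (count (fun x => x == v) s) cs => e cs; lia.
have [||] := IH (filter (fun x => x < v) s)
  (j - (count (fun x => v < x) s + count (fun x => x == v) s)); rewrite ?size_filter; [lia|lia|].
rewrite -cs; move: (tselect _ _ _) => t R T; split.
  by move=> js; apply: (@is_rank_below v); [rewrite cs | apply: R; lia].
by move: (count (fun x => x == v) s) cs => e cs; lia.
Qed.

(** * LR-trees *)

Section Trees.
Variables (U : finType).
Implicit Types (Pi : seq {ffun U -> nat}) (pi : {ffun U -> nat}) (e : U).

(** The equation [b.+1 = a + 2 ^ j] encodes that [[a:b]] is the interval of a node of height [j]; it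
    makes the halving exact and the two halves adjacent. *)
Lemma half_left a b j : b.+1 = a + 2 ^ j.+1 ->
  ((a + b - 1) %/ 2).+1 = a + 2 ^ j.
Proof. by rewrite expnS; lia. Qed.

Lemma half_right a b j : b.+1 = a + 2 ^ j.+1 ->
  (a + b + 1) %/ 2 = a + 2 ^ j.
Proof. by rewrite expnS; lia. Qed.

(** This is what allows [tincr] to leave a subtree untouched when its interval misses the new rank:
    all intervals below are contained in it. *)
Lemma lr_subtree_rcons_out Pi pi e j a b : b.+1 = a + 2 ^ j ->
  ~~ (a <= pi e <= b) -> lr_subtree (rcons Pi pi) e j a b = lr_subtree Pi e j a b.
Proof.
elim: j a b => [|j IH] a b ab out /=; rewrite -cats1 count_cat /= (negbTE out) ?addn0 //.
have hl := half_left ab; have hr := half_right ab.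
have := ab; rewrite expnS => ab'.
rewrite cats1 !IH //; lia.
Qed.

Lemma result_tincr Pi pi e j a b : b.+1 = a + 2 ^ j ->
  result (tincr (pi e) (lr_subtree Pi e j a b)) = lr_subtree (rcons Pi pi) e j a b.
Proof.
elim: j a b => [|j IH] a b ab /=; rewrite !timedE -cats1 count_cat /= addn0.
  have -> : b = a by move: ab; rewrite expn0; lia.
  by rewrite -eqn_leq; case: eqP => _; rewrite timedE ?addn0 ?addn1.
rewrite cats1; have hl := half_left ab; have hr := half_right ab.
have hr' : b.+1 = (a + b + 1) %/ 2 + 2 ^ j by move: ab; rewrite hr expnS; lia.
case: ifP => ab'; rewrite !timedE /=.
  by rewrite (IH _ _ hl) (IH _ _ hr') (addn1 (count _ _)).
by rewrite addn0 (lr_subtree_rcons_out _ hl) ?(lr_subtree_rcons_out _ hr') //; lia.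
Qed.

Lemma time_tincr_out Pi e x j a b : b.+1 = a + 2 ^ j -> ~~ (a <= x <= b) ->
  time (tincr x (lr_subtree Pi e j a b)) = 2.
Proof.
case: j => [|j] /= ab /negbTE out; rewrite !timedE ?out //.
by case: ifP => _; rewrite timedE.
Qed.

(* At most one child contains [x], and the other one costs a constant. *)
Lemma time_tincr Pi e x j a b : b.+1 = a + 2 ^ j ->
  time (tincr x (lr_subtree Pi e j a b)) <= 4 * j + 2.
Proof.
elim: j a b => [|j IH] a b ab /=; rewrite !timedE; first by case: ifP; rewrite timedE.
case: ifP => _; rewrite ?timedE; last by lia.
have hl := half_left ab; have hr := half_right ab.
have hr' : b.+1 = (a + b + 1) %/ 2 + 2 ^ j by move: ab; rewrite hr expnS; lia.
have := IH _ _ hl; have := IH _ _ hr'.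
case: (leqP x ((a + b - 1) %/ 2)) => xm.
  by rewrite (time_tincr_out _ _ hr') //; lia.
by rewrite (time_tincr_out _ _ hl) //; lia.
Qed.

Lemma node_p_lr_subtree Pi e j a b :
  node_p (lr_subtree Pi e j a b) = count (fun pi : {ffun U -> nat} => a <= pi e <= b) Pi.
Proof. by case: j. Qed.

(** The identity behind both score updates: moving left subtracts the count of a right child, moving
    right adds the count of a left child. *)
Lemma lr_score_split Pi e m a b : a = m.+1 -> m <= b ->
  lr_score Pi b e = lr_score Pi m e + count (fun pi : {ffun U -> nat} => a <= pi e <= b) Pi.
Proof. by move=> -> mb; rewrite /lr_score; elim: Pi => //= pi Pi ->; lia. Qed.

Lemma result_tupdate_trees pi (A : seq U) (T : {ffun U -> lrtree}) e : uniq A ->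
  result (tupdate_trees pi A T) e =
  if e \in A then result (tincr (pi e) (T e)) else T e.
Proof.
elim: A T => //= x A IH T /andP[xA uA]; rewrite !timedE IH // in_cons.
rewrite /set_tree ffunE; case: (eqVneq e x) => [->|_] //=.
by rewrite (negbTE xA).
Qed.

Lemma time_tupdate_trees c pi (A : seq U) (T : {ffun U -> lrtree}) : uniq A ->
  {in A, forall e, time (tincr (pi e) (T e)) <= c} ->
  time (tupdate_trees pi A T) <= (c + 3) * size A + 1.
Proof.
elim: A T => [|x A IH] T /= => [_ _|/andP[xA uA] Tc]; first by rewrite timedE; lia.
have := Tc x (mem_head _ _); rewrite !timedE mulnS.
set T' := set_tree _ _ _.
(* As there are no repetitions, replacing the tree of [x] leaves the trees of the remaining elements
   as they were. *)
suff /(IH T' uA) : {in A, forall e, time (tincr (pi e) (T' e)) <= c} by lia.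
move=> e eA.
have /negbTE nex : e != x by apply: contraNneq xA => <-.
by rewrite ffunE nex Tc // in_cons eA orbT.
Qed.
End Trees.

(** * Stable partition *)

Section Split.
Variables (U : eqType) (f : U -> nat).

(** Untimed counterpart of [tsplit] on bare elements, so that order and sizes are studied apart from
    entries and costs. *)
Fixpoint split_by (v r : nat) (D : seq U) : seq U * seq U :=
  match D with
  | [::] => ([::], [::])
  | x :: D' =>
      if v < f x then let LR := split_by v r D' in (x :: LR.1, LR.2)
      else if (f x == v) && (0 < r) then
        let LR := split_by v r.-1 D' in (x :: LR.1, LR.2)
      else let LR := split_by v r D' in (LR.1, x :: LR.2)
  end.

Lemma perm_split_by v r D :
  perm_eq ((split_by v r D).1 ++ (split_by v r D).2) D.
Proof.
elim: D r => //= x D IH r; case: ifP => _ /=; first by rewrite perm_cons.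
by case: ifP => _ /=; rewrite 1?perm_catC /= perm_cons // perm_catC.
Qed.

Lemma subseq_split_by v r D :
  subseq (split_by v r D).1 D /\ subseq (split_by v r D).2 D.
Proof.
elim: D r => //= x D IH r; have [L R] := IH r; have [L' R'] := IH r.-1.
case: ifP => _ /=; [|case: ifP => _ /=]; rewrite ?eqxx //; split=> //;
  by apply: subseq_trans (subseq_cons _ _).
Qed.

Lemma size_split_by v r D :
  size (split_by v r D).1 =
  count (fun x => v < f x) D + minn r (count (fun x => f x == v) D).
Proof.
elim: D r => [|x D IH] r /=; first by rewrite minn0.
case: (ltngtP v (f x)) => vx /=; rewrite ?IH; [lia | lia |].
by case: r => [|r] /=; rewrite IH; lia.
Qed.

(** The term [r == 0] records that, once the quota of ties is exhausted, only scores strictly above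
    [v] go left. In [split_by_order] this settles the case of a tied element sent right. *)
Lemma split_by_lower v r D e : e \in (split_by v r D).1 -> v + (r == 0) <= f e.
Proof.
elim: D r => //= x D IH r; case: ifP => vx /=.
  by rewrite in_cons => /orP[/eqP->|/IH //]; lia.
case: ifP => [/andP[/eqP xv r0]|_] /=; last exact: IH.
by rewrite in_cons => /orP[/eqP->|/IH]; lia.
Qed.

Lemma split_by_upper v r D e : e \in (split_by v r D).2 -> f e <= v.
Proof.
elim: D r => //= x D IH r; case: ifP => vx /=; first exact: IH.
case: ifP => [_|_] /=; first exact: IH.
by rewrite in_cons => /orP[/eqP->|/IH //]; lia.
Qed.

(** Equal scores across the cut must both be [v]; such elements occur in [D] by increasing [w], and
    the first [r] of them are those sent left. *)
Lemma split_by_order (w : U -> nat) v r D e e' :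
  pairwise (fun x y => w x < w y) D ->
  e \in (split_by v r D).1 -> e' \in (split_by v r D).2 ->
  f e' < f e \/ f e = f e' /\ w e < w e'.
Proof.
elim: D r => //= x D IH r /andP[/allP xD pD].
case: ifP => vx /=.
  rewrite in_cons => /orP[/eqP-> /split_by_upper|]; [by left; lia | exact: IH].
case: ifP => [/andP[/eqP xv r0]|xv] /=.
  rewrite in_cons => /orP[/eqP-> e'R|]; last exact: IH.
  have := split_by_upper e'R; rewrite -xv leq_eqVlt => /orP[/eqP E|]; last by left.
  right; split=> //; apply: xD; have [_ /mem_subseq] := subseq_split_by v r.-1 D.
  exact.
move=> eL; rewrite in_cons => /orP[/eqP->|]; last exact: IH.
by left; have := split_by_lower eL; lia.
Qed.

Variable mk : U -> entry U.
Hypothesis score_mk : forall e, score (mk e) = f e.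

Lemma result_tsplit v r D :
  result (tsplit v r (map mk D)) =
  (map mk (split_by v r D).1, map mk (split_by v r D).2).
Proof.
elim: D r => //= x D IH r; rewrite !timedE score_mk.
case: ifP => _; rewrite !timedE ?IH //.
by case: ifP => _; rewrite !timedE IH.
Qed.

Lemma time_tsplit v r (B : seq (entry U)) : time (tsplit v r B) <= 3 * size B + 1.
Proof.
elim: B r => //= x B IH r; have := IH r; have := IH r.-1; rewrite !timedE.
by case: ifP => _; rewrite !timedE; [lia|case: ifP => _; rewrite !timedE; lia].
Qed.

Lemma result_tcount_above v D :
  result (tcount_above v (map mk D)) = count (fun x => v < f x) D.
Proof.
elim: D => //= x D IH; rewrite !timedE score_mk IH.
by case: ifP; rewrite timedE.
Qed.

Lemma time_tcount_above v (B : seq (entry U)) :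
  time (tcount_above v B) <= 2 * size B + 1.
Proof. by elim: B => //= x B IH; rewrite !timedE; case: ifP; rewrite timedE; lia. Qed.

Lemma tpartition_medianP s mid t D : size D = (t - s).+1 -> mid - s <= t - s ->
  exists v r,
  [/\ result (tpartition_median s mid t (map mk D)) =
        (map mk (split_by v r D).1, map mk (split_by v r D).2),
      size (split_by v r D).1 = (mid - s).+1 &
      time (tpartition_median s mid t (map mk D)) <= 307 * size D + 10].
Proof.
move=> sD ms; rewrite /tpartition_median.
move: tselect tselectP => sel selP; rewrite !timedE result_tmap.
have := @time_tmap _ _ (fun x : entry U => op (score x)) 1 (map mk D) (fun=> leqnn 1).
set scores := map _ (map mk D); have scE : scores = map f D.
  by rewrite /scores -map_comp; apply: eq_map => e /=; rewrite timedE score_mk.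
have le : size scores <= (t - s).+1 by rewrite scE size_map sD.
have [] := selP _ _ (mid - s) le isT; rewrite scE size_map sD.
move: (sel _ _ _) => tv /(_ ms).
rewrite /is_rank (count_le_split (result tv)) !count_map result_tcount_above.
rewrite -[count _ D]/(count (fun x => result tv < f x) D).
rewrite -[count (preim f (eq_op^~ _)) D]/(count (fun x => f x == result tv) D).
move=> rk tvt ttm.
(* Since [v] has rank [mid - s], at most [mid - s] scores lie above it: the truncated subtraction is
   exact, and [r] does not exceed the number of ties. The left part thus gets exactly [(mid - s).+1]
   entries. *)
set r := _.+1 - _; exists (result tv), r; split; first exact: result_tsplit.
  rewrite size_split_by /r; move: rk.
  move: (count (fun x => f x == result tv) D); lia.
(* The slope 307 is 300 for selection, 2 for reading the scores, 2 for counting and 3 for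
   splitting. *)
have := time_tsplit (result tv) r (map mk D).
have := time_tcount_above (result tv) (map mk D).
by move: ttm; rewrite !size_map sD; lia.
Qed.

End Split.

(** * The recursive procedure *)

Section Recursion.
Variables (U : finType) (Pi : seq {ffun U -> nat}) (w : U -> nat).

(** Every block of the recursion is the image of a list of elements under this map, which builds the
    invariant on current nodes and scores into its form. *)
Definition lr_entry (j s t : nat) (e : U) : entry U :=
  Entry e (lr_subtree Pi e j s t) (lr_score Pi ((s + t - 1) %/ 2) e).

Lemma map_elt_lr_entry j s t D : map (@elt U) (map (lr_entry j s t) D) = D.
Proof. by rewrite -map_comp map_id. Qed.

(** The height [j.+2], ensured by the guard [s + 1 < t], means that the child reached is not a leaf,
    so [p_rc] reads a genuine counter. The truncated subtraction is exact because the rankings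
    removed are among those counted. *)
Lemma result_move_left j s t e : t.+1 = s + 2 ^ j.+2 ->
  result (move_left (lr_entry j.+2 s t e)) = lr_entry j.+1 s ((s + t - 1) %/ 2) e.
Proof.
move=> st; rewrite /move_left !timedE /= /lr_entry node_p_lr_subtree; congr Entry.
have h1 := half_left st; have h2 := half_left h1; have h3 := half_right h1.
rewrite (@lr_score_split _ Pi e ((s + (s + t - 1) %/ 2 - 1) %/ 2) _
  ((s + t - 1) %/ 2) (etrans h3 (esym h2))).
  by rewrite addnK.
by move: h1; rewrite expnS; lia.
Qed.

Lemma result_move_right j s t e : t.+1 = s + 2 ^ j.+2 ->
  result (move_right (lr_entry j.+2 s t e)) = lr_entry j.+1 ((s + t - 1) %/ 2).+1 t e.
Proof.
move=> st; rewrite /move_right !timedE /= /lr_entry node_p_lr_subtree.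
have h1 := half_left st; have h2 := half_right st; rewrite h2 -h1; congr Entry.
rewrite -(@lr_score_split _ Pi e) //.
by move: st h1; rewrite !expnS; lia.
Qed.

Lemma time_move_left (x : entry U) : time (move_left x) <= 3.
Proof. by []. Qed.

Lemma time_move_right (x : entry U) : time (move_right x) <= 3.
Proof. by []. Qed.

Definition lr_before (b : nat) (e f : U) : Prop :=
  lr_score Pi b f < lr_score Pi b e \/
  lr_score Pi b e = lr_score Pi b f /\ w e < w f.

(* [D] lists the elements placed in the interval of a node of height [j] with
   left endpoint [s]. *)
Fixpoint lr_block (j s : nat) (D : seq U) : Prop :=
  if j is j'.+1 then
    let L := take (2 ^ j') D in
    let R := drop (2 ^ j') D in
    [/\ forall e f, e \in L -> f \in R -> lr_before (s + 2 ^ j' - 1) e f,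
        lr_block j' s L & lr_block j' (s + 2 ^ j') R]
  else True.

(** Fuel above the height suffices, since each call halves the block. The factor [j.+1] bounds the
    number of levels, and 330 covers the 307 of the partition, the moves and the concatenation. *)
Lemma lr_recP fuel j s t D : j < fuel -> t.+1 = s + 2 ^ j -> size D = 2 ^ j ->
  pairwise (fun e f => w e < w f) D ->
  let m := lr_rec fuel s t (map (lr_entry j s t) D) in
  [/\ perm_eq (map (@elt U) (result m)) D,
      lr_block j s (map (@elt U) (result m)) &
      time m <= 330 * (2 ^ j * j.+1)].
Proof.
elim: fuel j s t D => // fuel IH j s t D jf st sD pD /=.
have pos : 0 < 2 ^ j by rewrite expn_gt0.
have [||v [r [res szL tm]]] := @tpartition_medianP _
  (lr_score Pi ((s + t - 1) %/ 2)) (lr_entry j s t) (fun=> erefl) s ((s + t) %/ 2) t D.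
- by rewrite sD; lia.
- by lia.
rewrite sD in tm.
move: tpartition_median res tm => tpm res tm; rewrite !timedE res /=.
move: (time (tpm _ _ _ _ _)) tm {res} => c tm.
have := perm_split_by (lr_score Pi ((s + t - 1) %/ 2)) v r D.
have := @split_by_order _ (lr_score Pi ((s + t - 1) %/ 2)) w v r D.
have := subseq_split_by (lr_score Pi ((s + t - 1) %/ 2)) v r D.
move: (split_by _ _ _ _) szL => [L R] /= szL [sL sR] ord pLR.
have pwL := subseq_pairwise sL pD; have pwR := subseq_pairwise sR pD.
have szLR : size L + size R = 2 ^ j by rewrite -sD -(perm_size pLR) size_cat.
case: ifP => deep; last first.
  rewrite result_tcat time_tcat map_cat !map_elt_lr_entry size_map; split=> //; last first.
    by move: (size L) (size R) szLR => nL nR szLR; rewrite mulnS; lia.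
  (* The recursion stops at one or two elements; for two, the partition alone already gives the
     required order. *)
  case: j jf st sD pos deep tm szLR => [|[|j]] //= _ st sD _ deep _ szLR; last first.
    by move: deep st; rewrite !expnS; have := expn_gt0 2 j; lia.
  have sz1 : size L = 2 ^ 0 by rewrite szL; lia.
  split=> // e f; rewrite -sz1 take_size_cat // drop_size_cat // => eL fR.
  by have -> : s + size L - 1 = (s + t - 1) %/ 2 by [lia]; apply: ord.
have [j' jE] : exists j', j = j'.+2.
  case: j deep st {IH jf sD pos tm szLR} => [|[|j']] deep st; [lia|lia|by exists j'].
subst j.
have hm := half_left st; set m := (s + t - 1) %/ 2 in ord hm *.
(* The sum [s + t] is odd, so the midpoint of the array agrees with that of the tree. *)
have -> : (s + t) %/ 2 = m by rewrite /m; move: st; rewrite expnS; lia.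
have hr : t.+1 = m.+1 + 2 ^ j'.+1 by rewrite hm; move: st; rewrite expnS; lia.
have szL' : size L = 2 ^ j'.+1 by rewrite szL; move: st; rewrite expnS; lia.
have szR' : size R = 2 ^ j'.+1 by move: szLR; rewrite szL' [2 ^ j'.+2]expnS; lia.
have jf' : j'.+1 < fuel by lia.
have [pL bL tL] := IH j'.+1 s m L jf' hm szL' pwL.
have [pR bR tR] := IH j'.+1 m.+1 t R jf' hr szR' pwR.
have ttL := @time_tmap _ _ (@move_left U) 3 (map (lr_entry j'.+2 s t) L) time_move_left.
have ttR := @time_tmap _ _ (@move_right U) 3 (map (lr_entry j'.+2 s t) R) time_move_right.
have EL : result (tmap (@move_left U) (map (lr_entry j'.+2 s t) L)) =
    map (lr_entry j'.+1 s m) L.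
  by rewrite result_tmap -map_comp; apply: eq_map => e /=; rewrite result_move_left.
have ER : result (tmap (@move_right U) (map (lr_entry j'.+2 s t) R)) =
    map (lr_entry j'.+1 m.+1 t) R.
  by rewrite result_tmap -map_comp; apply: eq_map => e /=; rewrite result_move_right.
have sL' : size (map (@elt U) (result (lr_rec fuel s m (map (lr_entry j'.+1 s m) L)))) =
    2 ^ j'.+1.
  by rewrite (perm_size pL).
move: EL ER ttL ttR; rewrite !size_map szL' szR'.
move: (tmap _ _) (tmap _ _) => mL mR EL ER ttL ttR.
rewrite !timedE EL ER; move: (lr_rec _ _ _ _) (lr_rec _ _ _ _) pL bL tL pR bR tR sL'.
move=> rL rR pL bL tL pR bR tR sL'.
rewrite result_tcat time_tcat map_cat; split.
- by apply: (perm_trans _ pLR); apply: perm_cat.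
(* The recursive calls only permute each half, so the comparison across the cut survives. *)
- split; rewrite ?take_size_cat ?drop_size_cat // -?hm // => e f.
  rewrite (perm_mem pL) (perm_mem pR) subn1 /=; exact: ord.
rewrite size_map in sL'; rewrite sL'; move: tm tL tR ttL ttR pos.
rewrite [2 ^ j'.+2]expnS; move: (2 ^ j'.+1) => N; nia.
Qed.
End Recursion.

(** * One step of the algorithm *)

Section Step.
Variable U : finType.
Implicit Types (Pi : seq {ffun U -> nat}) (pi : {ffun U -> nat}).

(** Descending from the root, the halves of an interval correspond to the [take] and [drop] of its
    block. Ranks start at 1 and array positions at 0, hence the offset [a.-1]. *)
Lemma lr_interval_block Pi (w : U -> nat) k A a b :
  lr_interval (2 ^ k) a b -> size A = 2 ^ k -> lr_block Pi w k 1 A ->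
  exists j, [/\ 0 < a, b.+1 = a + 2 ^ j &
                lr_block Pi w j a (take (2 ^ j) (drop a.-1 A))].
Proof.
move=> ab sA bA; elim: a b / ab => [|a b _ [j [a0 ab bl]] lt|a b _ [j [a0 ab bl]] lt].
- by exists k; rewrite drop0 -sA take_size.
- case: j ab bl => [|j] ab bl; first by move: lt ab; rewrite expn0; lia.
  have hl := half_left ab; exists j; split=> //.
  by case: bl; rewrite take_takel // expnS; lia.
case: j ab bl => [|j] ab bl; first by move: lt ab; rewrite expn0; lia.
have hr := half_right ab; exists j; rewrite hr; split;
  [by lia | by move: ab; rewrite expnS; lia |].
case: bl => _ _; rewrite expnS mul2n -addnn -take_drop drop_drop.
by have -> : 2 ^ j + a.-1 = (a + 2 ^ j).-1 by lia.
Qed.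

Lemma mem_take_drop_index (A : seq U) e i n : e \in A ->
  i <= index e A < i + n -> e \in take n (drop i A).
Proof.
move=> eA ien; have <- : nth e (take n (drop i A)) (index e A - i) = e.
  by rewrite nth_take ?nth_drop ?subnKC ?nth_index //; lia.
apply: mem_nth; rewrite size_take size_drop.
by have := eA; rewrite -index_mem; case: ifP => _ ?; lia.
Qed.

Lemma is_ranking_ranking_of (A : seq U) : perm_eq A (enum U) -> is_ranking (ranking_of A).
Proof.
move=> pA; have inA e : e \in A by rewrite (perm_mem pA) mem_enum.
have sA : size A = #|U| by rewrite (perm_size pA) -cardE.
have uA : uniq A by rewrite (perm_uniq pA) enum_uniq.
split=> [e f|i]; first by rewrite !ffunE => -[]; apply: index_inj.
rewrite -sA; split=> [iA|[e <-]]; last by rewrite ffunE /= index_mem.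
have [x _] : exists x : U, True by case: (A) iA => [|x ?]; [rewrite /=; lia | exists x].
by exists (nth x A i.-1); case: i iA => // i iA; rewrite ffunE index_uniq.
Qed.

Lemma lr_block_aggregated Pi (w : {ffun U -> nat}) k A :
  #|U| = 2 ^ k -> perm_eq A (enum U) -> lr_block Pi w k 1 A ->
  is_aggregated_ranking Pi w (ranking_of A).
Proof.
move=> Uk pA bA; split; first exact: is_ranking_ranking_of.
have sA : size A = 2 ^ k by rewrite (perm_size pA) -cardE.
have inA e : e \in A by rewrite (perm_mem pA) mem_enum.
move=> a b e f; rewrite Uk => int lt.
have [j [a0 ab bl]] := lr_interval_block int sA bA.
case: j ab bl => [|j] ab bl; first by move: lt ab; rewrite expn0; lia.
have hl := half_left ab; have hb : b.+1 = a + 2 ^ j + 2 ^ j by move: ab; rewrite expnS; lia.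
case: bl => bef _ _; rewrite !ffunE /= => eI fI.
have := bef e f; rewrite -hl subn1 /=; apply.
  by rewrite take_takel ?mem_take_drop_index // ?expnS; lia.
rewrite expnS mul2n -addnn -take_drop drop_drop mem_take_drop_index //.
lia.
Qed.

Lemma ranking_gt0 pi e : is_ranking pi -> 0 < pi e.
Proof. by case=> _ /(_ (pi e)) [_ h]; case/andP: (h (ex_intro _ e erefl)). Qed.

(** The counter of the left child requires a rank at least 1, the score does not; they agree because
    ranks are positive. *)
Lemma lr_score_root Pi k e : #|U| = 2 ^ k ->
  (forall rho, rho \in Pi -> is_ranking rho) ->
  p_lc (lr_tree k Pi e) = lr_score Pi ((1 + #|U| - 1) %/ 2) e.
Proof.
move=> Uk rk; rewrite /lr_tree /lr_score; case: k Uk => [|k] Uk /=.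
  (* With a single element the midpoint is 0 and no rank is that small, in agreement with the
     default 0 of [p_lc] on a leaf. *)
  rewrite Uk; apply/esym/eqP; rewrite -leqn0 leqNgt -has_count.
  by apply/hasPn => rho /rk r /=; have := ranking_gt0 e r; lia.
rewrite node_p_lr_subtree; apply: eq_in_count => rho /rk r.
by rewrite ranking_gt0.
Qed.

(** Supplies the order hypothesis of [lr_recP] at the root, the previous ranking being read off the
    array itself. *)
Lemma pairwise_index (A : seq U) : uniq A ->
  pairwise (fun e f => ranking_of A e < ranking_of A f) A.
Proof.
move=> uA; case: A uA => // x A' uA; set A := x :: A' in uA *.
apply/(pairwiseP x) => i j; rewrite !inE => iA jA ij.
by rewrite !ffunE !index_uniq.
Qed.

(** Beyond the 330 of [lr_recP], tree updates cost [4 * k + 5] per element, while attaching nodes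
    and reading the result back cost a constant per element; 350 covers all of it. The factor [k.+1]
    lets the bound include [k = 0]. *)
Lemma lr_stepP Pi k pi (st : lr_state U) : #|U| = 2 ^ k ->
  perm_eq (st_A st) (enum U) -> (forall e, st_T st e = lr_tree k Pi e) ->
  (forall rho, rho \in rcons Pi pi -> is_ranking rho) ->
  let step := lr_step st pi in
  [/\ perm_eq (st_A (result step)) (enum U),
      lr_block (rcons Pi pi) (ranking_of (st_A st)) k 1 (st_A (result step)),
      forall e, st_T (result step) e = lr_tree k (rcons Pi pi) e &
      time step <= 350 * (2 ^ k * k.+1)].
Proof.
move=> Uk pA ET rk; rewrite /lr_step.
have root : #|U|.+1 = 1 + 2 ^ k by rewrite Uk.
have uA : uniq (st_A st) by rewrite (perm_uniq pA) enum_uniq.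
have sA : size (st_A st) = 2 ^ k by rewrite (perm_size pA) -cardE.
have tt : time (tupdate_trees pi (st_A st) (st_T st)) <= (4 * k + 2 + 3) * 2 ^ k + 1.
  by rewrite -sA; apply: time_tupdate_trees => // e _; rewrite ET; apply: time_tincr.
have rt e : result (tupdate_trees pi (st_A st) (st_T st)) e = lr_tree k (rcons Pi pi) e.
  by rewrite result_tupdate_trees // (perm_mem pA) mem_enum ET /lr_tree result_tincr.
move: (tupdate_trees _ _ _) tt rt => upd tt rt; rewrite !timedE.
have ta : time (tmap (tattach (result upd)) (st_A st)) <= 4 * 2 ^ k + 1.
  by rewrite -sA; apply: time_tmap.
have ra : result (tmap (tattach (result upd)) (st_A st)) =
    map (lr_entry (rcons Pi pi) k 1 #|U|) (st_A st).
  rewrite result_tmap; apply: eq_map => e; rewrite /tattach !timedE rt lr_score_root //.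
move: (tmap (tattach _) _) ta ra => att ta ra.
have fuel : k < #|U| by rewrite Uk ltn_expl.
have := lr_recP (rcons Pi pi) fuel root sA (pairwise_index uA).
rewrite ra; move: (lr_rec _ _ _ _) => B [pB bB tB].
have te := @time_tmap _ _ (fun x : entry U => op (elt x)) 1 (result B) (fun=> leqnn 1).
have re : result (tmap (fun x : entry U => op (elt x)) (result B)) = map (@elt U) (result B).
  by rewrite result_tmap.
have sB : size (result B) = 2 ^ k by rewrite -(size_map (@elt U)) (perm_size pB).
move: (tmap _ _) te re => tB' te re; rewrite re /=; split=> //; first exact: perm_trans pB pA.
have pos : 0 < 2 ^ k by rewrite expn_gt0.
by move: te; rewrite sB; move: tt ta tB pos; move: (2 ^ k) => N; nia.
Qed.

(** The state hypotheses of [lr_stepP] reappear in its conclusion, so they propagate along the list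
    of rankings. *)
Lemma lr_runP Pi k A0 : #|U| = 2 ^ k -> perm_eq A0 (enum U) ->
  (forall rho, rho \in Pi -> is_ranking rho) ->
  perm_eq (st_A (lr_run k A0 Pi)) (enum U) /\
  forall e, st_T (lr_run k A0 Pi) e = lr_tree k Pi e.
Proof.
move=> Uk pA0; elim/last_ind: Pi => [|Pi pi IH] rk; first by split=> // e; rewrite ffunE.
have [pA ET] : perm_eq (st_A (lr_run k A0 Pi)) (enum U) /\
    forall e, st_T (lr_run k A0 Pi) e = lr_tree k Pi e.
  by apply: IH => rho rPi; apply: rk; rewrite mem_rcons inE rPi orbT.
rewrite /lr_run foldl_rcons -/(lr_run k A0 Pi).
by have [] := lr_stepP Uk pA ET rk.
Qed.

End Step.

Theorem theorem3 :
  exists C : nat,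
  forall (U : finType) (k : nat) (A0 : seq U)
         (Pi : seq {ffun U -> nat}) (pi : {ffun U -> nat}),
    #|U| = 2 ^ k ->
    perm_eq A0 (enum U) ->
    (forall rho : {ffun U -> nat}, rho \in Pi -> is_ranking rho) ->
    is_ranking pi ->
    let state_m := lr_run k A0 Pi in
    let step := lr_step state_m pi in
    [/\ is_aggregated_ranking (rcons Pi pi)
          (ranking_of (st_A state_m)) (ranking_of (st_A (result step))),
        (forall e : U, st_T (result step) e = lr_tree k (rcons Pi pi) e)
      & 2 <= #|U| -> time step <= C * (#|U| * trunc_log 2 #|U|)].
Proof.
(* Here 700 is twice 350: two or more elements force [k >= 1], hence [k.+1 <= 2 * k]. *)
exists 700 => U k A0 Pi pi Uk pA0 rPi rpi state_m step.
have rk rho : rho \in rcons Pi pi -> is_ranking rho.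
  by rewrite mem_rcons inE => /orP[/eqP->|/rPi].
have [pA ET] := lr_runP Uk pA0 rPi.
have [pA' bA' ET' tm] := lr_stepP Uk pA ET rk.
split=> //; first exact: lr_block_aggregated bA'.
rewrite Uk trunc_expnK // => k1; apply: leq_trans tm _.
have : 0 < k by case: (k) k1.
by move: (2 ^ k) => N; nia.
Qed.
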